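(* Any pointed regular factor permutable category with coequalizers satisfies (P).
   Context: Property (P) for a category $\mathbb{C}$ with binary products: for any two coequalizer diagrams $C_1 \rightrightarrows X \xrightarrow{q_1} X'$ (with parallel pair $u,v$) and $C_2 \rightrightarrows Y \xrightarrow{q_2} Y'$ (with parallel pair $u',v'$) in $\mathbb{C}$, the diagram $C_1\times C_2 \rightrightarrows X\times Y \xrightarrow{q_1\times q_2} X'\times Y'$ (with parallel pair $u\times u'$, $v\times v'$) is a coequalizer diagram in $\mathbb{C}$. A factor relation on an object $X$ is an equivalence relation on $X$ which is the kernel pair of a product projection, i.e. of $\pi_1$ for some product diagram $A\xleftarrow{\pi_1}X\xrightarrow{\pi_2}B$. A regular category $\mathbb{C}$ is factor permutable if $F\circ E=E\circ F$ (composition of relations) for any factor relation $F$ and any equivalence relation $E$ on any object $X$ of $\mathbb{C}$. Regular categories are assumed to have finite limits. *)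

(* Defs.v *)
From Corelib Require Export RelationClasses.
From mathcomp Require Export all_boot.

Set Implicit Arguments.
Unset Strict Implicit.
Unset Printing Implicit Defensive.

Declare Scope cat_scope.
Delimit Scope cat_scope with cat.

Record Category := {
  Obj :> Type;
  Hom : Obj -> Obj -> Type;
  idm : forall A, Hom A A;
  compm : forall A B D, Hom B D -> Hom A B -> Hom A D;
  compm_idl : forall A B (f : Hom A B), compm (idm B) f = f;
  compm_idr : forall A B (f : Hom A B), compm f (idm A) = f;
  compmA : forall A B D E (h : Hom D E) (g : Hom B D) (f : Hom A B),
    compm h (compm g f) = compm (compm h g) f
}.

Arguments Hom {c} A B.
Arguments idm {c} A.
Arguments compm {c A B D} g f.

Notation "g ∘ f" := (compm g f) (at level 40, left associativity) : cat_scope.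
Open Scope cat_scope.

Section CategoryNotions.
Variable C : Category.

Definition is_terminal (T : C) : Prop :=
  forall A : C, exists! f : Hom A T, True.

Definition is_initial (I : C) : Prop :=
  forall A : C, exists! f : Hom I A, True.

Definition pointed : Prop :=
  exists Z : C, is_initial Z /\ is_terminal Z.

(* Diagrams indexed by a finite graph.  A functor from a finite category is in
   particular such a diagram, on the underlying graph, with the same cones;
   conversely limits of finite graphs exist as soon as limits of functors from
   finite categories do. *)
Record fin_diagram := {
  dgm_vertex : finType;
  dgm_edge : finType;
  dgm_src : dgm_edge -> dgm_vertex;
  dgm_tgt : dgm_edge -> dgm_vertex;
  dgm_obj : dgm_vertex -> C;
  dgm_map : forall e, Hom (dgm_obj (dgm_src e)) (dgm_obj (dgm_tgt e))
}.

Definition is_cone (D : fin_diagram) (L : C)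
    (p : forall i : dgm_vertex D, Hom L (dgm_obj i)) : Prop :=
  forall e : dgm_edge D, dgm_map e ∘ p (dgm_src e) = p (dgm_tgt e).

Definition is_limit (D : fin_diagram) (L : C)
    (p : forall i : dgm_vertex D, Hom L (dgm_obj i)) : Prop :=
  is_cone p /\
  forall (T : C) (x : forall i : dgm_vertex D, Hom T (dgm_obj i)),
    is_cone x -> exists! h : Hom T L, forall i, p i ∘ h = x i.

Definition has_finite_limits : Prop :=
  forall D : fin_diagram,
    exists (L : C) (p : forall i : dgm_vertex D, Hom L (dgm_obj i)),
      is_limit p.

Definition is_product (A B P : C) (p1 : Hom P A) (p2 : Hom P B) : Prop :=
  forall (T : C) (a : Hom T A) (b : Hom T B),
    exists! h : Hom T P, p1 ∘ h = a /\ p2 ∘ h = b.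

Definition is_pullback (A B D P : C) (f : Hom A D) (g : Hom B D)
    (p1 : Hom P A) (p2 : Hom P B) : Prop :=
  f ∘ p1 = g ∘ p2 /\
  forall (T : C) (a : Hom T A) (b : Hom T B), f ∘ a = g ∘ b ->
    exists! h : Hom T P, p1 ∘ h = a /\ p2 ∘ h = b.

Definition is_kernel_pair (X Y K : C) (f : Hom X Y) (k1 k2 : Hom K X) : Prop :=
  is_pullback f f k1 k2.

Definition is_coequalizer (K X Q : C) (u v : Hom K X) (q : Hom X Q) : Prop :=
  q ∘ u = q ∘ v /\
  forall (T : C) (f : Hom X T), f ∘ u = f ∘ v -> exists! h : Hom Q T, h ∘ q = f.

Definition has_coequalizers : Prop :=
  forall (K X : C) (u v : Hom K X),
    exists (Q : C) (q : Hom X Q), is_coequalizer u v q.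

Definition is_regular_epi (X Q : C) (q : Hom X Q) : Prop :=
  exists (K : C) (u v : Hom K X), is_coequalizer u v q.

Definition regular : Prop :=
  [/\ has_finite_limits,
      forall (X Y K : C) (f : Hom X Y) (k1 k2 : Hom K X),
        is_kernel_pair f k1 k2 ->
        exists (Q : C) (q : Hom X Q), is_coequalizer k1 k2 q
    & forall (A B D P : C) (f : Hom A D) (g : Hom B D)
        (p1 : Hom P A) (p2 : Hom P B),
        is_pullback f g p1 p2 -> is_regular_epi f -> is_regular_epi p2].

(* A relation on X is a subobject of X * X, given by a jointly monic pair. *)
Record relation_on (X : C) := {
  rel_obj : C;
  rel_fst : Hom rel_obj X;
  rel_snd : Hom rel_obj X;
  rel_monic : forall (T : C) (a b : Hom T rel_obj),
    rel_fst ∘ a = rel_fst ∘ b -> rel_snd ∘ a = rel_snd ∘ b -> a = b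
}.

Definition rel_le (X : C) (R S : relation_on X) : Prop :=
  exists h : Hom (rel_obj R) (rel_obj S),
    rel_fst S ∘ h = rel_fst R /\ rel_snd S ∘ h = rel_snd R.

(* Equality of relations as subobjects. *)
Definition rel_eq (X : C) (R S : relation_on X) : Prop :=
  rel_le R S /\ rel_le S R.

(* The relation induced by R on the generalized elements T -> X. *)
Definition rel_mem (X : C) (R : relation_on X) (T : C) (x y : Hom T X) : Prop :=
  exists h : Hom T (rel_obj R), rel_fst R ∘ h = x /\ rel_snd R ∘ h = y.

Definition is_equivalence_relation (X : C) (R : relation_on X) : Prop :=
  forall T : C, Equivalence (@rel_mem X R T).

(* T is the composite of R followed by S: the regular epi / mono image in
   X * X of the pullback of rel_snd R and rel_fst S.  In a regular category it
   exists and is unique up to rel_eq. *)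
Definition is_rel_comp (X : C) (S R T : relation_on X) : Prop :=
  exists (P : C) (p1 : Hom P (rel_obj R)) (p2 : Hom P (rel_obj S))
         (e : Hom P (rel_obj T)),
    [/\ is_pullback (rel_snd R) (rel_fst S) p1 p2,
        is_regular_epi e,
        rel_fst T ∘ e = rel_fst R ∘ p1
      & rel_snd T ∘ e = rel_snd S ∘ p2].

Definition is_factor_relation (X : C) (F : relation_on X) : Prop :=
  is_equivalence_relation F /\
  exists (A B : C) (pi1 : Hom X A) (pi2 : Hom X B),
    is_product pi1 pi2 /\ is_kernel_pair pi1 (rel_fst F) (rel_snd F).

Definition factor_permutable : Prop :=
  forall (X : C) (F E : relation_on X),
    is_factor_relation F -> is_equivalence_relation E ->
    forall FE EF : relation_on X,
      is_rel_comp F E FE -> is_rel_comp E F EF -> rel_eq FE EF.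

(* h is f * g, with respect to product cones (p1, p2) and (q1, q2). *)
Definition is_product_map (A B P A' B' P' : C)
    (p1 : Hom P A) (p2 : Hom P B) (q1 : Hom P' A') (q2 : Hom P' B')
    (f : Hom A A') (g : Hom B B') (h : Hom P P') : Prop :=
  q1 ∘ h = f ∘ p1 /\ q2 ∘ h = g ∘ p2.

(* Products are not chosen: the property is stated for all product cones on
   the three pairs of objects. *)
Definition property_P : Prop :=
  forall (C1 X X' C2 Y Y' : C)
    (u v : Hom C1 X) (q1 : Hom X X') (u' v' : Hom C2 Y) (q2 : Hom Y Y'),
    is_coequalizer u v q1 -> is_coequalizer u' v' q2 ->
  forall (C12 XY XY' : C)
    (c1 : Hom C12 C1) (c2 : Hom C12 C2)
    (x1 : Hom XY X) (x2 : Hom XY Y)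
    (y1 : Hom XY' X') (y2 : Hom XY' Y')
    (uu vv : Hom C12 XY) (qq : Hom XY XY'),
    is_product c1 c2 -> is_product x1 x2 -> is_product y1 y2 ->
    is_product_map c1 c2 x1 x2 u u' uu ->
    is_product_map c1 c2 x1 x2 v v' vv ->
    is_product_map x1 x2 y1 y2 q1 q2 qq ->
    is_coequalizer uu vv qq.

End CategoryNotions.

(* Main.v *)
Require Import Defs.

Set Implicit Arguments.
Unset Strict Implicit.
Unset Printing Implicit Defensive.

(** Every [f] out of a product [X × Y] satisfies a shifting lemma: if [a, b] and
    [c, d] are opposite horizontal sides of a rectangle and [f a = f b], then
    [f c = f d].  Indeed [c F a G b], where [F] is the kernel pair of the first
    projection and [G] is the intersection of the kernel pairs of [f] and of the
    second projection; as [F] permutes with [G], locally [c G z F b] for some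
    [z], and the coordinates of [z] force [z = d].

    Now let [f] coequalize [u × u'] and [v × v'].  Composing with the canonical
    injections provided by zero morphisms, [f (-, 0)] coequalizes [u, v] and
    [f (0, -)] coequalizes [u', v'].  By the shifting lemma [f] does not separate
    elements identified by [q1 × 1] or by [1 × q2].  These are pullbacks of [q1]
    and [q2], hence regular epimorphisms, so [f] factors through one after the
    other. *)

(** * Products and regular epimorphisms on generalized elements *)

Section Products.
Variable C : Category.

Lemma product_pair (A B P : C) (p1 : Hom P A) (p2 : Hom P B) :
  is_product p1 p2 -> forall (T : C) (a : Hom T A) (b : Hom T B),
  exists h : Hom T P, p1 ∘ h = a /\ p2 ∘ h = b.
Proof. by move=> pP T a b; case: (pP T a b) => h [hP _]; exists h. Qed.

Lemma product_ext (A B P : C) (p1 : Hom P A) (p2 : Hom P B) :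
  is_product p1 p2 -> forall (T : C) (g h : Hom T P),
  p1 ∘ g = p1 ∘ h -> p2 ∘ g = p2 ∘ h -> g = h.
Proof.
move=> pP T g h e1 e2; case: (pP T (p1 ∘ h) (p2 ∘ h)) => k [_ kU].
by rewrite -(kU g) ?(kU h).
Qed.

Lemma product_sym (A B P : C) (p1 : Hom P A) (p2 : Hom P B) :
  is_product p1 p2 -> is_product p2 p1.
Proof.
move=> pP T b a; case: (pP T a b) => h [[e1 e2] hU]; exists h; split=> //.
by move=> k [k1 k2]; apply: hU.
Qed.

(** This exhibits [h], the map [q × 1], as a base change of [q]; in a regular category it is then a
    regular epimorphism whenever [q] is. *)
Lemma product_map_pullback (A A' B P P' : C) (p1 : Hom P A) (p2 : Hom P B)
    (r1 : Hom P' A') (r2 : Hom P' B) (q : Hom A A') (h : Hom P P') :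
  is_product p1 p2 -> is_product r1 r2 ->
  r1 ∘ h = q ∘ p1 -> r2 ∘ h = p2 -> is_pullback q r1 p1 h.
Proof.
move=> pP rP h1 h2; split=> // T a b eab.
case: (product_pair pP a (r2 ∘ b)) => k [k1 k2]; exists k; split.
  split=> //; apply: (product_ext rP).
    by rewrite compmA h1 -compmA k1.
  by rewrite compmA h2.
move=> k' [k'1 k'2]; apply: (product_ext pP); first by rewrite k1.
by rewrite k2 -h2 -k'2 compmA.
Qed.

Lemma regular_epi_cancel (X Q : C) (q : Hom X Q) : is_regular_epi q ->
  forall (T : C) (g h : Hom Q T), g ∘ q = h ∘ q -> g = h.
Proof.
move=> [K [u [v [quv qU]]]] T g h egh.
case: (qU T (h ∘ q)) => [|k [_ kU]]; first by rewrite -!compmA quv.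
by rewrite -(kU g) ?(kU h).
Qed.

(** The parallel pair coequalized by [q] is itself a pair of generalized elements that [q]
    identifies. *)
Lemma regular_epi_factor (X Q : C) (q : Hom X Q) : is_regular_epi q ->
  forall (T : C) (f : Hom X T),
  (forall (S : C) (s t : Hom S X), q ∘ s = q ∘ t -> f ∘ s = f ∘ t) ->
  exists h : Hom Q T, h ∘ q = f.
Proof.
move=> [K [u [v [quv qU]]]] T f fP.
by case: (qU T f (fP _ _ _ quv)) => h [hP _]; exists h.
Qed.

End Products.

(** * Particular finite limits *)

Section FiniteLimits.
Variable C : Category.
Hypothesis hlim : has_finite_limits C.

Lemma product_exists (A B : C) :
  exists (P : C) (p1 : Hom P A) (p2 : Hom P B), is_product p1 p2.
Proof.
pose ob (b : bool) : C := if b then A else B.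
pose D : fin_diagram C := @Build_fin_diagram C bool void
  (fun e => match e with end) (fun e => match e with end) ob
  (fun e => match e with end).
have [P [p [_ pU]]] := hlim D.
exists P, (p true), (p false) => T a b.
pose x (i : dgm_vertex D) : Hom T (dgm_obj i) :=
  match i return Hom T (ob i) with true => a | false => b end.
have [|h [hP hU]] := pU T x; first by case.
exists h; split; first by split; [apply: (hP true) | apply: (hP false)].
by move=> k [k1 k2]; apply: hU; case.
Qed.

Lemma pullback_exists (A B E : C) (f : Hom A E) (g : Hom B E) :
  exists (P : C) (p1 : Hom P A) (p2 : Hom P B), is_pullback f g p1 p2.
Proof.
pose ob (o : option bool) : C :=
  match o with None => E | Some true => A | Some false => B end.
pose D : fin_diagram C := @Build_fin_diagram C (option bool) bool
  (fun e => Some e) (fun _ => None) ob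
  (fun e => match e return Hom (ob (Some e)) E with true => f | false => g end).
have [P [p [pc pU]]] := hlim D.
exists P, (p (Some true)), (p (Some false)); split.
  by rewrite [LHS](pc true) [RHS](pc false).
move=> T a b eab.
pose x (i : dgm_vertex D) : Hom T (dgm_obj i) :=
  match i return Hom T (ob i) with
  | None => f ∘ a | Some true => a | Some false => b end.
have [|h [hP hU]] := pU T x; first by case; rewrite //= eab.
exists h; split; first by split; [apply: (hP (Some true)) | apply: (hP (Some false))].
move=> k [k1 k2]; apply: hU => -[[]|] //=.
by rewrite -k1 compmA; congr (_ ∘ _); rewrite -(pc true).
Qed.

(** The limit of two copies of [X], each mapped to both [A] and [B]. Taking [a] and [b] equal gives
    an ordinary kernel pair, in general an intersection of two. *)
Lemma joint_kernel_pair (X A B : C) (a : Hom X A) (b : Hom X B) :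
  exists R : relation_on X, forall (T : C) (s t : Hom T X),
    rel_mem R s t <-> a ∘ s = a ∘ t /\ b ∘ s = b ∘ t.
Proof.
pose ob (o : bool + bool) : C :=
  match o with inl _ => X | inr true => A | inr false => B end.
pose D : fin_diagram C := @Build_fin_diagram C (bool + bool)%type (bool * bool)%type
  (fun e => inl e.1) (fun e => inr e.2) ob
  (fun e => match e.2 as j return Hom X (ob (inr j)) with
            | true => a | false => b end).
have [P [p [pc pU]]] := hlim D.
pose k1 : Hom P X := p (inl true); pose k2 : Hom P X := p (inl false).
have ka : a ∘ k1 = a ∘ k2.
  by rewrite [LHS](pc (true, true)) [RHS](pc (false, true)).
have kb : b ∘ k1 = b ∘ k2.
  by rewrite [LHS](pc (true, false)) [RHS](pc (false, false)).
have kP T (s t : Hom T X) : a ∘ s = a ∘ t -> b ∘ s = b ∘ t ->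
    exists! h : Hom T P, k1 ∘ h = s /\ k2 ∘ h = t.
  move=> ea eb.
  pose x (i : dgm_vertex D) : Hom T (dgm_obj i) :=
    match i return Hom T (ob i) with
    | inl true => s | inl false => t | inr true => a ∘ s | inr false => b ∘ s end.
  have [|h [hP hU]] := pU T x; first by case=> [[] []] //=; rewrite (ea, eb).
  exists h; split; first by split; [apply: (hP (inl true)) | apply: (hP (inl false))].
  move=> k [ek1 ek2]; apply: hU => -[[]|[]] //=; rewrite -ek1 compmA.
    by congr (_ ∘ _); rewrite -(pc (true, true)).
  by congr (_ ∘ _); rewrite -(pc (true, false)).
have kM T (s t : Hom T P) : k1 ∘ s = k1 ∘ t -> k2 ∘ s = k2 ∘ t -> s = t.
  move=> e1 e2; case: (kP T (k1 ∘ t) (k2 ∘ t)); rewrite ?compmA ?ka ?kb //.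
  by move=> h [_ hU]; rewrite -(hU s) ?(hU t).
exists (Build_relation_on kM) => T s t; split=> [[h [/= <- <-]]|[ea eb]].
  by rewrite !compmA ka kb.
by case: (kP T s t ea eb) => h [hP _]; exists h.
Qed.

End FiniteLimits.

(** * Images and composites of relations *)

Lemma rel_mem_generic (C : Category) (X : C) (R : relation_on X) :
  rel_mem R (rel_fst R) (rel_snd R).
Proof. by exists (idm _); rewrite !compm_idr. Qed.

Section Regular.
Variable C : Category.
Hypothesis hregular : regular C.

(** Pulling [q] back along [t] gives the cover [r]: elements lift along [q] locally. *)
Lemma regular_epi_lift (X Q T : C) (q : Hom X Q) (t : Hom T Q) :
  is_regular_epi q -> exists (S : C) (r : Hom S T) (s : Hom S X),
    is_regular_epi r /\ q ∘ s = t ∘ r.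
Proof.
move=> qr; have [hlim _ hst] := hregular.
have [S [s [r pb]]] := pullback_exists hlim q t.
by exists S, r, s; split; [apply: hst pb qr | case: pb].
Qed.

(** The image of [(a, b)] is the coequalizer of the joint kernel pair of [a] and [b]. *)
Lemma joint_image (P X : C) (a b : Hom P X) : has_coequalizers C ->
  exists (I : relation_on X) (e : Hom P (rel_obj I)),
    [/\ is_regular_epi e, rel_fst I ∘ e = a & rel_snd I ∘ e = b].
Proof.
move=> hcoeq; have [hlim _ _] := hregular.
have [K KP] := joint_kernel_pair hlim a b.
have [ka kb] := (KP _ _ _).1 (rel_mem_generic K).
have [Q [e [ek eU]]] := hcoeq _ _ (rel_fst K) (rel_snd K).
have er : is_regular_epi e by exists (rel_obj K), (rel_fst K), (rel_snd K).
have [m [em _]] := eU _ a ka; have [n [en _]] := eU _ b kb.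
(* Over a common cover [s] and [t] lift to [P]; [a] and [b] identify the lifts, which therefore
   factor through [K], and [e] identifies them too. *)
have mnM T (s t : Hom T Q) : m ∘ s = m ∘ t -> n ∘ s = n ∘ t -> s = t.
  move=> ems ens.
  have [T1 [r1 [s1 [r1e es1]]]] := regular_epi_lift s er.
  have [T2 [r2 [t2 [r2e et2]]]] := regular_epi_lift (t ∘ r1) er.
  apply: (regular_epi_cancel r1e); apply: (regular_epi_cancel r2e).
  rewrite -et2 -es1 -compmA.
  have [|h [<- <-]] := (KP _ (s1 ∘ r2) t2).2; last first.
    by rewrite !compmA ek.
  by rewrite -em -en -!compmA et2 (compmA e) es1 !compmA ems ens.
by exists (Build_relation_on mnM), e.
Qed.

Lemma rel_comp_exists (X : C) (S R : relation_on X) : has_coequalizers C ->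
  exists T : relation_on X, is_rel_comp S R T.
Proof.
move=> hcoeq; have [hlim _ _] := hregular.
have [P [p1 [p2 pb]]] := pullback_exists hlim (rel_snd R) (rel_fst S).
have [I [e [er ef es]]] := joint_image (rel_fst R ∘ p1) (rel_snd S ∘ p2) hcoeq.
by exists I, P, p1, p2, e.
Qed.

Lemma rel_comp_mem (X : C) (S R RS : relation_on X) : is_rel_comp S R RS ->
  forall (T : C) (x y z : Hom T X),
  rel_mem R x y -> rel_mem S y z -> rel_mem RS x z.
Proof.
move=> [P [p1 [p2 [e [[_ pU] _ ef es]]]]] T x y z [h [<- hy]] [k [ky <-]].
have [|l [[<- <-] _]] := pU T h k; first by rewrite hy ky.
by exists (e ∘ l); rewrite !compmA ef es.
Qed.

(** The middle element [y] exists only over a cover, since the composite is an image. *)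
Lemma rel_comp_split (X : C) (S R RS : relation_on X) : is_rel_comp S R RS ->
  forall (T : C) (x z : Hom T X), rel_mem RS x z ->
  exists (T' : C) (r : Hom T' T) (y : Hom T' X),
    [/\ is_regular_epi r, rel_mem R (x ∘ r) y & rel_mem S y (z ∘ r)].
Proof.
move=> [P [p1 [p2 [e [[pc _] er ef es]]]]] T x z [h [<- <-]].
have [T' [r [l [rr el]]]] := regular_epi_lift h er.
exists T', r, (rel_snd R ∘ p1 ∘ l); split=> //.
  by exists (p1 ∘ l); split; rewrite ?compmA // -[RHS]compmA -el compmA ef.
exists (p2 ∘ l); split; first by rewrite compmA -pc.
by rewrite -[RHS]compmA -el !compmA es.
Qed.

End Regular.

Lemma rel_le_mem (C : Category) (X : C) (R S : relation_on X) : rel_le R S ->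
  forall (T : C) (x y : Hom T X), rel_mem R x y -> rel_mem S x y.
Proof.
by move=> [h [e1 e2]] T x y [k [<- <-]]; exists (h ∘ k); rewrite !compmA e1 e2.
Qed.

Lemma joint_kernel_equivalence (C : Category) (X A B : C) (R : relation_on X)
    (a : Hom X A) (b : Hom X B) :
  (forall (T : C) (s t : Hom T X),
    rel_mem R s t <-> a ∘ s = a ∘ t /\ b ∘ s = b ∘ t) ->
  is_equivalence_relation R.
Proof.
move=> RP T; split.
- by move=> s; apply/RP.
- by move=> s t /RP[e1 e2]; apply/RP.
- by move=> s t w /RP[e1 e2] /RP[e3 e4]; apply/RP; rewrite e1 e2.
Qed.

(** * Shifting along projections and coequalizers *)

Section FactorPermutable.
Variable C : Category.
Hypotheses (hregular : regular C) (hfactor : factor_permutable C).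
Hypothesis hcoeq : has_coequalizers C.

Lemma projection_shift (X Y P T : C) (p1 : Hom P X) (p2 : Hom P Y)
    (f : Hom P T) : is_product p1 p2 ->
  forall (S : C) (a b c d : Hom S P),
  p1 ∘ a = p1 ∘ c -> p1 ∘ b = p1 ∘ d -> p2 ∘ a = p2 ∘ b -> p2 ∘ c = p2 ∘ d ->
  f ∘ a = f ∘ b -> f ∘ c = f ∘ d.
Proof.
move=> pP S a b c d ac bd ab cd fab; have [hlim _ _] := hregular.
have [F FP] := joint_kernel_pair hlim p1 p1.
have [G GP] := joint_kernel_pair hlim f p2.
have Ffactor : is_factor_relation F.
  split; first exact: joint_kernel_equivalence FP.
  exists X, Y, p1, p2; split=> //; split.
    exact: ((FP _ _ _).1 (rel_mem_generic F)).1.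
  move=> U s t est; have [|h [h1 h2]] := (FP U s t).2; first by [].
  exists h; split=> // k [k1 k2].
  by apply: (rel_monic (r := F)); rewrite ?h1 ?h2.
(* [FG] is [G] followed by [F], and [GF] is [F] followed by [G]. *)
have [FG FGP] := rel_comp_exists hregular F G hcoeq.
have [GF GFP] := rel_comp_exists hregular G F hcoeq.
have [_ le] := hfactor Ffactor (joint_kernel_equivalence GP) FGP GFP.
have cGFb : rel_mem GF c b.
  apply: (rel_comp_mem GFP (y := a)); first by apply/FP.
  by apply/GP.
have [S' [r [z [rr /GP[fz p2z] /FP[p1z _]]]]] :=
  rel_comp_split hregular FGP (rel_le_mem le cGFb).
apply: (regular_epi_cancel rr); rewrite -!compmA fz; congr (_ ∘ _).
apply: (product_ext pP); first by rewrite p1z !compmA bd.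
by rewrite -p2z !compmA cd.
Qed.

Lemma coequalizer_shift (C1 C2 C12 X X' Y P T : C) (u v : Hom C1 X)
    (u' v' : Hom C2 Y) (q : Hom X X') (c1 : Hom C12 C1) (c2 : Hom C12 C2)
    (p1 : Hom P X) (p2 : Hom P Y) (uu vv : Hom C12 P) (f : Hom P T) :
  pointed C -> is_coequalizer u v q -> is_product c1 c2 -> is_product p1 p2 ->
  is_product_map c1 c2 p1 p2 u u' uu -> is_product_map c1 c2 p1 p2 v v' vv ->
  f ∘ uu = f ∘ vv ->
  forall (S : C) (s t : Hom S P),
  q ∘ (p1 ∘ s) = q ∘ (p1 ∘ t) -> p2 ∘ s = p2 ∘ t -> f ∘ s = f ∘ t.
Proof.
move=> [Z [Zi Zt]] [_ qU] cP pP [uu1 uu2] [vv1 vv2] fuv S s t q1 e2.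
have iE A (g h : Hom Z A) : g = h.
  by case: (Zi A) => k [_ kU]; rewrite -(kU g) ?(kU h).
have tE A (g h : Hom A Z) : g = h.
  by case: (Zt A) => k [_ kU]; rewrite -(kU g) ?(kU h).
have [tX _] := Zt X; have [tC _] := Zt C1.
have [iY _] := Zi Y; have [iC _] := Zi C2.
(* [w] is the injection [x ↦ (x, 0)] of [X], and [j] the analogous one of [C1]. As [u'] and [v']
   preserve zero, [w] turns [u] and [v] into [uu ∘ j] and [vv ∘ j]. *)
have [w [w1 w2]] := product_pair pP (idm X) (iY ∘ tX).
have [j [j1 j2]] := product_pair cP (idm C1) (iC ∘ tC).
have wE (z : Hom C1 X) (z' : Hom C2 Y) (zz : Hom C12 P) :
    p1 ∘ zz = z ∘ c1 -> p2 ∘ zz = z' ∘ c2 -> w ∘ z = zz ∘ j.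
  move=> e1 e3; apply: (product_ext pP).
    by rewrite !compmA w1 e1 -[RHS]compmA j1 compm_idl compm_idr.
  rewrite !compmA w2 e3 -[RHS]compmA j2 compmA (iE _ (z' ∘ iC) iY) -compmA.
  by rewrite (tE _ (tX ∘ z) tC).
have fw : f ∘ w ∘ u = f ∘ w ∘ v.
  by rewrite -!compmA (wE _ _ _ uu1 uu2) (wE _ _ _ vv1 vv2) !compmA fuv.
have [g [gq _]] := qU _ _ fw.
(* The rectangle has sides [(p1 s, 0), (p1 t, 0)] and [s, t]; on the first side [f] factors through
   [q]. *)
apply: (projection_shift pP (a := w ∘ (p1 ∘ s)) (b := w ∘ (p1 ∘ t))) => //.
- by rewrite compmA w1 compm_idl.
- by rewrite compmA w1 compm_idl.
- by rewrite !(compmA p2) w2 -!(compmA iY); congr (_ ∘ _); apply: tE.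
- by rewrite !(compmA f) -gq -!(compmA g) q1.
Qed.

End FactorPermutable.

Theorem proposition6 (C : Category)
  (hpointed : pointed C) (hregular : regular C)
  (hfactor : factor_permutable C) (hcoeq : has_coequalizers C) :
  property_P C.
Proof.
move=> C1 X X' C2 Y Y' u v q1 u' v' q2 hq1 hq2.
move=> C12 XY XY' c1 c2 x1 x2 y1 y2 uu vv qq cP xP yP huu hvv [qq1 qq2].
have [[uu1 uu2] [vv1 vv2]] := (huu, hvv).
have [[q1uv _] [q2uv _]] := (hq1, hq2); have [hlim _ hst] := hregular.
(* Through [M = X' × Y], [qq] splits as [l = q1 × 1] followed by [r = 1 × q2]. *)
have [M [m1 [m2 mP]]] := product_exists hlim X' Y.
have [l [l1 l2]] := product_pair mP (q1 ∘ x1) x2.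
have [r [r1 r2]] := product_pair yP m1 (q2 ∘ m2).
have lr : is_regular_epi l.
  apply: hst (product_map_pullback xP mP l1 l2) _.
  by exists C1, u, v.
have rr : is_regular_epi r.
  apply: hst (product_map_pullback (product_sym mP) (product_sym yP) r2 r1) _.
  by exists C2, u', v'.
have qqE : qq = r ∘ l.
  apply: (product_ext yP); first by rewrite qq1 compmA r1 l1.
  by rewrite qq2 compmA r2 -compmA l2.
split.
  apply: (product_ext yP); rewrite !compmA (qq1, qq2) -!compmA.
    by rewrite uu1 vv1 !compmA q1uv.
  by rewrite uu2 vv2 !compmA q2uv.
move=> T f fuv.
have shift1 := coequalizer_shift hregular hfactor hcoeq hpointed hq1 cP xP
  huu hvv fuv.
(* The same with the two factors exchanged. *)
have shift2 := coequalizer_shift hregular hfactor hcoeq hpointed hq2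
  (product_sym cP) (product_sym xP) (conj uu2 uu1) (conj vv2 vv1) fuv.
have [|g gl] := regular_epi_factor lr (f := f).
  move=> S s t est; apply: shift1; last by rewrite -l2 -!compmA est.
  by rewrite !compmA -l1 -!compmA est.
have [|h hr] := regular_epi_factor rr (f := g).
  move=> S s t est.
  have m1st : m1 ∘ s = m1 ∘ t by rewrite -r1 -!compmA est.
  have m2st : q2 ∘ (m2 ∘ s) = q2 ∘ (m2 ∘ t).
    by rewrite !compmA -r2 -!compmA est.
  (* Lift [s] along the epimorphism [l], then change the second coordinate of
     the lift to that of [t]; this is a lift of [t]. *)
  have [S' [e [s' [er ls']]]] := regular_epi_lift hregular s lr.
  have [t' [t1 t2]] := product_pair xP (x1 ∘ s') (m2 ∘ t ∘ e).
  have x2s' : x2 ∘ s' = m2 ∘ s ∘ e by rewrite -l2 -!compmA ls'.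
  have lt' : l ∘ t' = t ∘ e.
    apply: (product_ext mP); last by rewrite compmA l2 t2 compmA.
    by rewrite !compmA l1 -compmA t1 compmA -l1 -m1st -!compmA ls'.
  apply: (regular_epi_cancel er).
  (* The lifts [s'] and [t'] agree in [X], and [q2] identifies their coordinates in [Y]. *)
  rewrite -!compmA -ls' -lt' !compmA gl; apply: shift2; last by rewrite t1.
  by rewrite t2 x2s' !(compmA q2) in m2st *; rewrite m2st.
exists h; split; first by rewrite qqE compmA hr gl.
move=> h' h'P; apply: (regular_epi_cancel rr); apply: (regular_epi_cancel lr).
by rewrite hr gl -compmA -qqE h'P.
Qed.
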